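(* For hanging families of bottomless rectangles, $m_k^*\le 2k-1$. That is, for every positive integer $k$, every finite hanging family $\mathcal{F}$ of bottomless rectangles can be $k$-coloured so that every point of $\mathbb{R}^2$ covered by at least $2k-1$ rectangles of $\mathcal{F}$ is covered by rectangles of all $k$ colours.
   Context: A (closed) bottomless rectangle is a subset of $\mathbb{R}^2$ of the form $\{(x,y): l\le x\le r,\ y\le t\}$, denoted by its parameters $(l,r,t)$. A family of bottomless rectangles is hanging if the left endpoints of the top sides of its members, i.e. the points $(l,t)$, all lie on a fixed line with positive slope (which may be taken to be $y=x$). For a class of families, $m_k^*$ is the smallest number $m$ such that every finite family in the class can be $k$-coloured so that every point covered by at least $m$ members of the family is covered by members of all $k$ colours. *)

(* Defs.v *)
From mathcomp Require Import all_boot all_order all_algebra.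
From mathcomp Require Import reals.

Set Implicit Arguments.
Unset Strict Implicit.
Unset Printing Implicit Defensive.

Import Order.TTheory GRing.Theory Num.Theory.

Local Open Scope ring_scope.

(* If [bl_right] is smaller than [bl_left], the rectangle is empty. *)
Record bottomless (R : realType) := Bottomless {
  bl_left : R;
  bl_right : R;
  bl_top : R
}.

Definition bl_region (R : realType) (B : bottomless R) : {pred R * R} :=
  [pred p : R * R | (bl_left B <= p.1 <= bl_right B) && (p.2 <= bl_top B)].

(* A finite family is a map from a finite index type, so that a rectangle may
   be repeated and is then counted, and coloured, with multiplicity. *)
Definition family_class (R : realType) :=
  forall I : finType, (I -> bottomless R) -> Prop.

Definition depth (R : realType) (I : finType) (F : I -> bottomless R)
    (p : R * R) : nat :=
  #|[set i | p \in bl_region (F i)]|.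

Definition polychromatic (R : realType) (k m : nat) (I : finType)
    (F : I -> bottomless R) (c : I -> 'I_k) : Prop :=
  forall p : R * R, (m <= depth F p)%N ->
    forall j : 'I_k, exists i : I, p \in bl_region (F i) /\ c i = j.

Definition polychromatic_bound (R : realType) (C : family_class R)
    (k m : nat) : Prop :=
  forall (I : finType) (F : I -> bottomless R), C I F ->
    exists c : I -> 'I_k, polychromatic m F c.

(* [is_mstar C k m] says that m_k^* exists for the class [C] and equals [m];
   it is a relation because for some classes no bound exists. *)
Definition is_mstar (R : realType) (C : family_class R) (k m : nat) : Prop :=
  polychromatic_bound C k m /\
  forall m' : nat, polychromatic_bound C k m' -> (m <= m')%N.

Definition hanging (R : realType) : family_class R :=
  fun (I : finType) (F : I -> bottomless R) =>
    exists a b : R, 0 < a /\ forall i : I, bl_top (F i) = a * bl_left (F i) + b.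

(* Main.v *)
Require Import Defs.
From mathcomp Require Import all_boot all_order all_algebra.
From mathcomp Require Import boolp reals.
From mathcomp Require Import zify.

Set Implicit Arguments.
Unset Strict Implicit.
Unset Printing Implicit Defensive.

Import Order.TTheory GRing.Theory Num.Theory.

Local Open Scope ring_scope.

(** Let the tops be [a * l + b].  A point (x, y) lies in a rectangle exactly
    when l <= x <= r and y <= a * l + b.  So it sees, among the rectangles
    alive at abscissa x (those with l <= x <= r), listed by increasing l with
    ties broken arbitrarily, a final segment of the list.  It is enough that at every x each final
    segment of size at least 2k - 1 shows all k colours.

    Sweep x from right to left.  Rectangles then enter the list anywhere
    (when x passes r) and leave it only at its right end (when x passes l).
    Colour lazily, keeping the invariant [spaced]: two alive rectangles of
    the same colour have at least k - 1 alive rectangles between them in the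
    list.  An entering rectangle is uncoloured and can only push others
    apart; when one leaves at the right end, whatever lies between two
    remaining ones remains too.  So the sweep itself preserves the invariant.

    Suppose now that a final segment Q with |Q| >= 2k - 1 misses a colour d.
    A fully coloured final segment missing d has at most k - 1 members
    ([card_coloured_missing]), so Q has uncoloured members, and at most k - 1
    members of Q follow the last uncoloured one, u.  Give u the colour d.
    Every rectangle of colour d lies before Q, hence is separated from u by
    the members of Q before u, of which there are at least
    (2k - 1) - 1 - (k - 1) = k - 1: the invariant survives ([colour_one]).

    Only finitely many alive sets occur, so finitely many stops of the sweep
    suffice ([finite_representatives], [sweep]). *)

(** * Partial colourings of one linearly ordered set *)

Section OneSet.

Variables (k : nat) (I : finType) (pos : I -> nat).

Definition between (A : {set I}) (i j : I) : {set I} :=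
  [set z in A | (pos i < pos z < pos j)%N].

Definition spaced (A : {set I}) (col : I -> option 'I_k) : Prop :=
  forall i j, i \in A -> j \in A -> (pos i < pos j)%N ->
    col i = col j -> col i -> (k - 1 <= #|between A i j|)%N.

Definition final_segment (A Q : {set I}) : Prop :=
  Q \subset A /\
  forall i j, i \in Q -> j \in A -> (pos i < pos j)%N -> j \in Q.

Definition shows_all (A : {set I}) (col : I -> option 'I_k) : Prop :=
  forall Q, final_segment A Q -> (2 * k - 1 <= #|Q|)%N ->
    forall d, exists2 i, i \in Q & col i = Some d.

Definition extends (col col' : I -> option 'I_k) : Prop :=
  forall i, col i -> col' i = col i.

Lemma shows_all_extends A col col' :
  extends col col' -> shows_all A col -> shows_all A col'.
Proof.
move=> ext all Q fQ szQ d; have [i iQ ci] := all Q fQ szQ d.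
by exists i => //; rewrite ext ci.
Qed.

Lemma final_segment_after A Q u :
  final_segment A Q -> final_segment A [set z in Q | (pos u < pos z)%N].
Proof.
move=> [/subsetP QA upQ]; split.
  by apply/subsetP => z; rewrite inE => /andP[/QA].
move=> i j; rewrite !inE => /andP[iQ ui] jA ij.
by rewrite (upQ i) // (ltn_trans ui).
Qed.

Hypothesis pos_inj : injective pos.

(** If no colour repeats, count colours.  Otherwise let i be the last member
    whose colour occurs again later, at j say: beyond i no colour repeats, so
    at most k - 1 members follow i, and one of them is j, which leaves too few
    for the gap between i and j. *)
Lemma card_coloured_missing A X col d :
  spaced A col -> final_segment A X -> (forall i, i \in X -> col i) ->
  (forall i, i \in X -> col i <> Some d) -> (#|X| <= k - 1)%N.
Proof.
move=> sp [/subsetP XA upX] full miss.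
have few (Y : {set I}) : Y \subset X -> {in Y &, injective col} ->
    (#|Y| <= k - 1)%N.
  move=> /subsetP YX inj; pose c i := odflt d (col i).
  have injc : {in Y &, injective c}.
    move=> i j iY jY; rewrite /c => eqc; apply: inj => //.
    by move: (full i (YX _ iY)) (full j (YX _ jY)) eqc; case: (col i) => // ? _;
      case: (col j) => // ? _ /= ->.
  rewrite -(card_in_imset injc).
  have -> : (k - 1 = #|[set~ d]|)%N by rewrite cardsC1 card_ord subn1.
  apply/subset_leq_card/subsetP => e /imsetP[i iY ->]; rewrite !inE /c.
  apply/eqP; move: (full i (YX _ iY)) (miss i (YX _ iY)).
  by case: (col i) => // e' _ ne /= ee; apply: ne; rewrite ee.
pose rep i := (i \in X) &&
  [exists j, [&& j \in X, (pos i < pos j)%N & col i == col j]].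
case: (pickP rep) => [i0 rep0 | norep]; last first.
  apply: few => // i j iX jX eqc; apply: pos_inj.
  case: (ltngtP (pos i) (pos j)) => // lt.
    move: (norep i); rewrite /rep iX => /existsP[].
    by exists j; rewrite jX lt eqc eqxx.
  move: (norep j); rewrite /rep jX => /existsP[].
  by exists i; rewrite iX lt eqc eqxx.
case: (arg_maxnP pos rep0) => i /andP[iX /existsP[j /and3P[jX ij /eqP eqc]]] last_i.
pose Y := [set z in X | (pos i < pos z)%N].
have cardY : (#|Y| <= k - 1)%N.
  apply: few; first by apply/subsetP => z; rewrite inE => /andP[].
  move=> y z; rewrite !inE => /andP[yX iy] /andP[zX iz] eqyz; apply: pos_inj.
  case: (ltngtP (pos y) (pos z)) => // lt.
    have : rep y by rewrite /rep yX; apply/existsP; exists z; rewrite zX lt eqyz eqxx.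
    by move/last_i => le; move: (leq_ltn_trans le iy); rewrite ltnn.
  have : rep z by rewrite /rep zX; apply/existsP; exists y; rewrite yX lt eqyz eqxx.
  by move/last_i => le; move: (leq_ltn_trans le iz); rewrite ltnn.
have := sp i j (XA _ iX) (XA _ jX) ij eqc (full i iX).
have jY : j \in Y by rewrite inE jX ij.
have : (#|between A i j| <= #|Y :\ j|)%N.
  apply/subset_leq_card/subsetP => z; rewrite !inE => /and3P[zA iz zj].
  rewrite iz (upX i) // !andbT; apply/eqP => ezj.
  by move: zj; rewrite ezj ltnn.
by move: cardY; rewrite (cardsD1 j Y) jY; lia.
Qed.

(** One step of the lazy colouring: the last uncoloured member of a deficient
    final segment receives the missing colour. *)
Lemma colour_one A Q col d :
  spaced A col -> final_segment A Q -> (2 * k - 1 <= #|Q|)%N ->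
  (forall i, i \in Q -> col i <> Some d) ->
  exists2 u, u \in A /\ col u = None &
    spaced A (fun i => if i == u then Some d else col i).
Proof.
move=> sp fQ szQ miss; have [/subsetP QA upQ] := fQ.
have k_gt0 : (0 < k)%N by apply: leq_ltn_trans (ltn_ord d).
pose blank i := (i \in Q) && ~~ col i.
case: (pickP blank) => [u0 blank0 | noblank]; last first.
  have : (#|Q| <= k - 1)%N.
    apply: card_coloured_missing sp fQ _ miss => i iQ.
    by move: (noblank i); rewrite /blank iQ => /negbFE.
  by lia.
case: (arg_maxnP pos blank0) => u /andP[uQ blank_u] last_u.
have cu : col u = None by case: (col u) blank_u.
exists u; first by split=> //; apply: QA.
pose X := [set z in Q | (pos u < pos z)%N].
have cardX : (#|X| <= k - 1)%N.
  apply: card_coloured_missing sp (final_segment_after u fQ) _ _ => i;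
    rewrite inE => /andP[iQ ui]; last exact: miss.
  case ci: (col i) => //.
  have : blank i by rewrite /blank iQ ci.
  by move/last_u => le; move: (leq_ltn_trans le ui); rewrite ltnn.
move=> i j iA jA ij.
case: (eqVneq i u) => [eiu | _].
  subst i; case: (eqVneq j u) => [eju | _]; first by move: ij; rewrite eju ltnn.
  by move=> cj _; case: (miss j (upQ u j uQ jA ij)).
case: (eqVneq j u) => [eju | _]; last exact: sp.
subst j => ci _.
have iNQ : i \notin Q by apply/negP => /miss.
have : (#|Q :\ u| <= #|between A i u| + #|X|)%N.
  apply: leq_trans (leq_of_leqif (leq_card_setU _ _)).
  apply/subset_leq_card/subsetP => z; rewrite !inE => /andP[zu zQ].
  rewrite zQ (QA z zQ) /=.
  have -> : (pos i < pos z)%N.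
    rewrite ltnNge leq_eqVlt; apply/negP => /orP[/eqP/pos_inj ezi | zi].
      by move: iNQ; rewrite -ezi zQ.
    by move: iNQ; rewrite (upQ z).
  rewrite /=; case: (ltngtP (pos z) (pos u)) => // /pos_inj ezu.
  by rewrite ezu eqxx in zu.
by move: szQ cardX; rewrite (cardsD1 u Q) uQ; lia.
Qed.

(** Repairing one deficient final segment after another terminates because
    each repair uses up an uncoloured element, and it never spoils an earlier
    repair because colours are only added. *)
Lemma fill A col : spaced A col ->
  exists col', [/\ extends col col', spaced A col', shows_all A col' &
    forall i, col' i -> col i \/ i \in A].
Proof.
have [n] := ubnP #|[set i | ~~ col i]|.
elim: n col => // n IHn col szn sp.
have [all | nall] := pselect (shows_all A col).
  by exists col; split=> // i ci; left.
have [Q [fQ szQ [d miss]]] : exists Q, [/\ final_segment A Q,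
    (2 * k - 1 <= #|Q|)%N & exists d, forall i, i \in Q -> col i <> Some d].
  apply: contrapT => nex; apply: nall => Q fQ szQ d; apply: contrapT => nd.
  apply: nex; exists Q; split=> //; exists d => i iQ ci.
  by apply: nd; exists i.
have [u [uA cu] sp1] := colour_one sp fQ szQ miss.
set col1 := fun i => _ in sp1.
have ext1 : extends col col1.
  by move=> i; rewrite /col1; case: eqVneq => // ->; rewrite cu.
have [|//|col' [ext' sp' all' new']] := IHn col1.
  rewrite ltnS in szn; apply: leq_trans szn; apply: proper_card; apply/properP; split.
    apply/subsetP => i; rewrite !inE; apply: contraNN => ci.
    by rewrite ext1.
  by exists u; rewrite !inE ?cu // /col1 eqxx.
exists col'; split=> // i.
  by move=> ci; rewrite ext' ext1 //.
by move/new' => [|]; [rewrite /col1; case: eqVneq => [->|]; auto | auto].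
Qed.

End OneSet.

(** * Sweeping a line over intervals *)

Section Sweep.

Variables (R : realType) (k : nat) (I : finType) (l r : I -> R).

Definition alive (x : R) : {set I} := [set i | l i <= x <= r i].

Lemma order_by (f : I -> R) : exists2 pos : I -> nat, injective pos &
  forall i j, (pos i < pos j)%N -> f i <= f j.
Proof.
pose leI := relpre f <=%R; pose s := sort leI (enum I).
have mem_s i : i \in s by rewrite mem_sort mem_enum.
exists (index^~ s); first by move=> i j; apply: index_inj.
have leI_trans : transitive leI by move=> ? ? ?; apply: le_trans.
have sorted_s : sorted leI s.
  by apply: sort_sorted => ? ?; apply: le_total.
by move=> i j; apply: (sorted_ltn_index leI_trans sorted_s).
Qed.

Variable pos : I -> nat.
Hypothesis pos_inj : injective pos.
Hypothesis pos_le : forall i j, (pos i < pos j)%N -> l i <= l j.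

(** A coloured interval alive at y is alive at x too, because it reaches x.
    An interval z of the list at x that lies before some j alive at y starts
    before j does, so z has not been left behind at y: gaps never shrink. *)
Lemma spaced_left x y (col : I -> option 'I_k) : y <= x ->
  (forall i, col i -> x <= r i) ->
  spaced pos (alive x) col -> spaced pos (alive y) col.
Proof.
move=> yx reach sp i j; rewrite !inE => /andP[liy _] /andP[ljy _] ij eqc ci.
have alive_x z : l z <= y -> col z -> z \in alive x.
  by move=> lz cz; rewrite inE (le_trans lz yx) reach.
have cj : col j by rewrite -eqc.
apply: leq_trans (sp i j (alive_x i liy ci) (alive_x j ljy cj) ij eqc ci) _.
apply/subset_leq_card/subsetP => z; rewrite !inE.
move=> /andP[/andP[_ xr] /andP[iz zj]].
by rewrite iz zj (le_trans (pos_le zj) ljy) (le_trans yx xr).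
Qed.

(** The stops are visited from the last one to the first one, and the
    colouring is kept ready for any further stop on the left. *)
Lemma sweep (xs : seq R) : sorted <=%R xs ->
  exists col : I -> option 'I_k,
  [/\ forall x, x \in xs -> shows_all pos (alive x) col,
      forall y, {in xs, forall x, y <= x} -> spaced pos (alive y) col &
      forall i, col i -> exists2 x, x \in xs & x <= r i].
Proof.
elim: xs => [|x xs IHxs] sorted_xs; first by exists (fun=> None); split.
have [col [all sp reach]] := IHxs (path_sorted sorted_xs).
have min_x : {in xs, forall z, x <= z}.
  exact/allP/(order_path_min le_trans sorted_xs).
have [col' [ext sp' all' new]] := fill pos_inj (sp x min_x).
have reach' i : col' i -> x <= r i.
  case/new => [/reach[z zxs] | ]; first exact/le_trans/min_x.
  by rewrite inE => /andP[].
exists col'; split.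
- move=> z; rewrite inE => /orP[/eqP -> // | /all].
  exact: shows_all_extends.
- move=> y le_y; apply: spaced_left sp' => //.
  by apply: le_y; rewrite mem_head.
- by move=> i /reach' xr; exists x; rewrite ?mem_head.
Qed.

End Sweep.

Lemma finite_representatives (T : choiceType) (J : finType) (f : T -> J) :
  exists xs : seq T, forall x, exists2 y, y \in xs & f y = f x.
Proof.
suff [xs xsP] : exists xs : seq T,
    forall x, f x \in enum J -> exists2 y, y \in xs & f y = f x.
  by exists xs => x; apply: xsP; rewrite mem_enum.
elim: (enum J) => [|v vs [xs xsP]]; first by exists [::].
have [[x0 fx0] | novalue] := pselect (exists x, f x = v).
  exists (x0 :: xs) => x; rewrite inE => /orP[/eqP fx | /xsP[y yxs fy]].
    by exists x0; rewrite ?mem_head // fx.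
  by exists y; rewrite // inE yxs orbT.
exists xs => x; rewrite inE => /orP[/eqP fx | /xsP //].
by case: novalue; exists x.
Qed.

(** * Hanging families *)

Lemma hanging_polychromatic (R : realType) (k : nat) : (0 < k)%N ->
  polychromatic_bound (@hanging R) k (2 * k - 1).
Proof.
move=> k_gt0 I F [a [b [a_gt0 topE]]].
pose l i := bl_left (F i); pose r i := bl_right (F i).
have [pos pos_inj pos_le] := order_by l.
have [xs xsP] := finite_representatives (alive l r).
have [col [all _ _]] := sweep k r pos_inj pos_le (sort_sorted le_total xs).
exists (fun i => odflt (Ordinal k_gt0) (col i)) => -[x y] deep j.
pose Q := [set i | (x, y) \in bl_region (F i)].
have memQ i : (i \in Q) = (i \in alive l r x) && (y <= a * l i + b).
  by rewrite !inE /= topE.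
have fQ : final_segment pos (alive l r x) Q.
  split; first by apply/subsetP => i; rewrite memQ => /andP[].
  move=> i i'; rewrite !memQ => /andP[_ yi] -> /pos_le le_l /=.
  by apply: le_trans yi _; rewrite lerD2r ler_pM2l.
have [z zxs alive_z] := xsP x.
have := all z; rewrite mem_sort alive_z => /(_ zxs Q fQ deep j) [i iQ ci].
by exists i; rewrite ci; split=> //; move: iQ; rewrite inE.
Qed.

Theorem theorem2p8 (R : realType) (k : nat) (hk : (0 < k)%N) :
  (exists m : nat, is_mstar (@hanging R) k m /\ (m <= 2 * k - 1)%N) /\
  (forall (I : finType) (F : I -> bottomless R), hanging F ->
     exists c : I -> 'I_k,
       forall p : R * R, (2 * k - 1 <= #|[set i | p \in bl_region (F i)]|)%N ->
         forall j : 'I_k, exists i : I, p \in bl_region (F i) /\ c i = j).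
Proof.
have bound := @hanging_polychromatic R k hk.
split; last exact: bound.
pose isb m := `[< polychromatic_bound (@hanging R) k m >].
have ex_b : exists m, isb m by exists (2 * k - 1)%N; apply/asboolP.
case: (ex_minnP ex_b) => m /asboolP bm min_m.
exists m; split; last by apply/min_m/asboolP.
by split=> // m' bm'; apply/min_m/asboolP.
Qed.
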